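(* Let $k\ge d$, let $\mathbf a=(a_i)_{i=1}^k\in\mathbb R_{>0}^k$ with $a_1\ge\dots\ge a_k$, and let $f:[0,\infty)\to[0,\infty)$ be strictly convex. Endow $\mathcal C_{\mathbf a}(\emptyset)=\{\{g_i\}_{i=1}^k\in(\mathbb C^d)^k:\|g_i\|^2=a_i\ (1\le i\le k)\}$ with the product topology. Then the local minimizers and the global minimizers of the convex potential $P_f$ on $\mathcal C_{\mathbf a}(\emptyset)$ coincide.
   Context: For a finite sequence $\mathcal G=\{g_i\}_{i=1}^k$ in $\mathbb C^d$ its frame operator is $S_{\mathcal G}=\sum_{i=1}^k g_i\otimes g_i$, where $(x\otimes y)(z)=\langle z,y\rangle x$, and the convex potential induced by $f$ is $P_f(\mathcal G)=\operatorname{tr}f(S_{\mathcal G})=\sum_{i=1}^d f(\lambda_i(S_{\mathcal G}))$, where $\lambda_1(S_{\mathcal G}),\dots,\lambda_d(S_{\mathcal G})$ are the eigenvalues of $S_{\mathcal G}$ counted with multiplicity. *)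

(* Defs.v *)
From HB Require Import structures.
From mathcomp Require Import all_boot all_order all_algebra.
From mathcomp Require Import sesquilinear spectral complex.
From mathcomp Require Import all_classical all_reals all_analysis.

Set Implicit Arguments.
Unset Strict Implicit.
Unset Printing Implicit Defensive.

Import Order.TTheory GRing.Theory Num.Theory.
Import numFieldNormedType.Exports.

Local Open Scope classical_set_scope.
Local Open Scope ring_scope.
Local Open Scope complex_scope.
Local Open Scope sesquilinear_scope.

(* The library puts the norm topology on abstract [numFieldType]s only; these
   are the same copies for R[i], whose norm is the modulus.  The matrices
   ['cV[R[i]]_d] then carry the entrywise (= Euclidean) topology. *)
#[non_forgetful_inheritance]
HB.instance Definition _ (R : realType) := GRing.ComAlgebra.copy R[i] R[i]^o.
#[non_forgetful_inheritance]
HB.instance Definition _ (R : realType) := Vector.copy R[i] R[i]^o.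
#[non_forgetful_inheritance]
HB.instance Definition _ (R : realType) := NormedModule.copy R[i] R[i]^o.

(* Linear in the first argument, conjugate-linear in the second. *)
Definition inner (R : realType) (d : nat) (x y : 'cV[R[i]]_d) : R[i] :=
  \sum_(j < d) x j 0 * Num.conj (y j 0).

(* Column vectors: as an operator, [rank_one x y] is z |-> <z, y> x
   (lemma [rank_oneE] below). *)
Definition rank_one (R : realType) (d : nat) (x y : 'cV[R[i]]_d) : 'M[R[i]]_d :=
  x *m y^t*.

Lemma rank_oneE (R : realType) (d : nat) (x y z : 'cV[R[i]]_d) :
  rank_one x y *m z = inner z y *: x.
Proof.
rewrite /rank_one -mulmxA; apply/matrixP => i j; rewrite !ord1 !mxE big_ord1.
rewrite mulrC mxE; congr (_ * _); apply: eq_bigr => l _.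
by rewrite !mxE mulrC.
Qed.

Definition frame_operator (R : realType) (d k : nat)
    (g : 'I_k -> 'cV[R[i]]_d) : 'M[R[i]]_d :=
  \sum_(i < k) rank_one (g i) (g i).

Lemma frame_operator_hermitian (R : realType) (d k : nat)
    (g : 'I_k -> 'cV[R[i]]_d) : frame_operator g \is hermsymmx.
Proof.
apply/is_hermitianmxP; rewrite expr0 scale1r /frame_operator /rank_one.
rewrite linear_sum /= map_mx_sum; apply: eq_bigr => i _.
by rewrite trmx_mul map_mxM /= map_trmx trmxK -map_mx_comp (map_mx_id (@conjCK _)).
Qed.

(* The spectrum of the Hermitian matrix [frame_operator g] is real, so [complex.Re]
   only changes the type; see [frame_eigenvalue_char_poly] and
   [frame_eigenvalue_ge0] below. *)
Definition frame_eigenvalue (R : realType) (d k : nat)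
    (g : 'I_k -> 'cV[R[i]]_d) (j : 'I_d) : R :=
  complex.Re (spectral_diag (frame_operator g) 0 j).

Lemma frame_eigenvalueE (R : realType) (d k : nat)
    (g : 'I_k -> 'cV[R[i]]_d) (j : 'I_d) :
  (frame_eigenvalue g j)%:C = spectral_diag (frame_operator g) 0 j.
Proof.
have /hermitian_spectral_diag_real/mxOverP/(_ 0 j) :=
  frame_operator_hermitian g.
by rewrite /frame_eigenvalue => /RRe_real.
Qed.

Lemma frame_eigenvalue_char_poly (R : realType) (d k : nat)
    (g : 'I_k -> 'cV[R[i]]_d) :
  char_poly (frame_operator g) =
  \prod_(j < d) ('X - ((frame_eigenvalue g j)%:C)%:P).
Proof.
set S := frame_operator g.
have /hermitian_normalmx/orthomx_spectralP eqS := frame_operator_hermitian g.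
rewrite -/S in eqS; set P := spectralmx S in eqS.
set D := diag_mx _ in eqS.
have Pu : P \in unitmx by exact: spectral_unit.
have -> : char_poly S = char_poly D.
  rewrite /char_poly /char_poly_mx eqS !map_mxM /=.
  set Q := map_mx polyC P; set Q' := map_mx polyC (invmx P).
  have Q'Q : Q' *m Q = 1%:M by rewrite -map_mxM mulVmx// map_mx1.
  have {1}-> : 'X%:M = Q' *m 'X%:M *m Q :> 'M[{poly R[i]}]_d.
    by rewrite mul_mx_scalar -scalemxAl Q'Q scalemx1.
  rewrite -mulmxBl -mulmxBr !det_mulmx mulrAC -det_mulmx Q'Q det1 mul1r //.
rewrite char_poly_trig ?diag_mx_is_trig//.
by apply: eq_bigr => j _; rewrite frame_eigenvalueE !mxE eqxx mulr1n.
Qed.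

Lemma frame_eigenvalue_ge0 (R : realType) (d k : nat)
    (g : 'I_k -> 'cV[R[i]]_d) (j : 'I_d) : 0 <= frame_eigenvalue g j.
Proof.
rewrite -lecR frame_eigenvalueE; set S := frame_operator g.
have /hermitian_normalmx/orthomx_spectralP eqS := frame_operator_hermitian g.
rewrite -/S in eqS; set P := spectralmx S in eqS.
have Pu : P \in unitmx by exact: spectral_unit.
have eqD : diag_mx (spectral_diag S) = P *m S *m P^t*.
  rewrite -invmx_unitary ?spectral_unitarymx// [X in P *m X]eqS.
  by rewrite !mulmxA mulmxV// mul1mx mulmxK.
have -> : spectral_diag S 0 j = diag_mx (spectral_diag S) j j.
  by rewrite mxE eqxx mulr1n.
rewrite eqD /S /frame_operator mulmx_sumr mulmx_suml summxE sumr_ge0// => i _.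
rewrite /rank_one mulmxA -mulmxA.
have -> : (g i)^t* *m P^t* = (P *m g i)^t* by rewrite trmx_mul map_mxM.
by rewrite mxE big_ord1 [X in _ * X]mxE [X in _ * X^*]mxE mul_conjC_ge0.
Qed.

Definition convex_potential (R : realType) (d k : nat) (f : R -> R)
    (g : 'I_k -> 'cV[R[i]]_d) : R :=
  \sum_(j < d) f (frame_eigenvalue g j).

Definition strictly_convex_on (R : realType) (D : set R) (f : R -> R) : Prop :=
  forall x y t : R, D x -> D y -> x != y -> 0 < t < 1 ->
    f (t * x + (1 - t) * y) < t * f x + (1 - t) * f y.

(* [{ptws 'I_k -> _}] is ['I_k -> _] with the product topology. *)
Definition prescribed_norms (R : realType) (d k : nat) (a : 'I_k -> R) :
    set {ptws 'I_k -> 'cV[R[i]]_d} :=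
  [set g | forall i, inner (g i) (g i) = (a i)%:C].

Definition is_global_minimizer (R : realType) (T : Type) (A : set T)
    (F : T -> R) (x : T) : Prop :=
  A x /\ forall y, A y -> F x <= F y.

(* Local with respect to the subspace topology of A. *)
Definition is_local_minimizer (R : realType) (T : topologicalType) (A : set T)
    (F : T -> R) (x : T) : Prop :=
  A x /\ \forall y \near within A (nbhs x), F x <= F y.

(* Main.v *)
Require Import Defs.
From HB Require Import structures.
From mathcomp Require Import all_boot all_order all_algebra.
From mathcomp Require Import sesquilinear spectral complex.
From mathcomp Require Import all_classical all_reals all_analysis.
From mathcomp Require Import ring lra.

Set Implicit Arguments.
Unset Strict Implicit.
Unset Printing Implicit Defensive.

Import Order.TTheory GRing.Theory Num.Theory.
Import numFieldNormedType.Exports.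

Local Open Scope classical_set_scope.
Local Open Scope ring_scope.
Local Open Scope complex_scope.
Local Open Scope sesquilinear_scope.

(** A global minimizer is a local one, so only the converse has content.  Let
    [g] be a local minimizer with frame operator [S]; write [a i] for the
    prescribed squared norms.  The function [f] need not be differentiable,
    nor continuous at 0, so no derivative of the potential is available.
    Instead, small perturbations [g'] of [g] are compared with [g] by Klein's
    inequality [klein], written at the spectrum of the perturbed operator:
    if [s j] are the eigenvalues of [g'], with orthonormal eigenvectors [u j],
    and [h j] is a supporting slope of [f] at [s j], then
      P_f(g) >= P_f(g') + sum_j h_j (<S u_j, u_j> - s_j).
    As [h j] increases strictly with [s j], the last sum is positive as soon as
    the surplus [<S u_j, u_j> - s_j] is not identically zero and is positive
    only at larger eigenvalues than those where it is negative; this is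
    [convex_potential_descent].

    Every vector of [g] is an eigenvector of [S] ([local_minimizer_eigenvector]).
    Otherwise replace one vector [g i] by the outcome [v'] of an implicit
    Euler step, for the descent of [tr (S^2)] in that vector on its sphere.
    Implicitness makes [g i] an increasing affine function of the perturbed
    operator, applied to [v'], so in the new eigenbasis the surplus has the
    required sign pattern.

    If the eigenvalue of [g i] exceeds some eigenvalue [mu] of [S], then it equals
    [a i] ([local_minimizer_big]).  Otherwise [g i] satisfies a nontrivial linear
    relation with vectors of the same eigenspace; tilting these vectors towards
    an eigenvector [u] for [mu], in proportion to the coefficients of the
    relation, makes the cross terms cancel exactly, and the net effect on [S] is
    to move mass from the eigenspace of [g i] to [u] ([spectral_transfer]).

    Hence the spectrum of [S] is the list of the [max (a j) c], for [j < d], where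
    [c] is the least eigenvalue; [d <= k] forces [0 < c]
    ([water_filling_spectrum]).  Klein's inequality at this list, now along a
    Gram-Schmidt basis of the first [d] vectors of an arbitrary competitor, shows
    that no frame with the same norms has a smaller potential
    ([water_filling_optimal]). *)

(** * Squared moduli and orthonormal coordinates *)

Section Coordinates.
Variable R : realType.
Local Notation C := R[i].

Definition normsq (z : C) : R := complex.Re z ^+ 2 + complex.Im z ^+ 2.

Lemma normsqE (z : C) : (normsq z)%:C = z * Num.conj z.
Proof. by rewrite /normsq add_Re2_Im2 -normCK. Qed.

Lemma normsq_ge0 (z : C) : 0 <= normsq z.
Proof. by rewrite addr_ge0 ?sqr_ge0. Qed.

Lemma normsq0 : normsq 0 = 0.
Proof. by rewrite /normsq /= expr0n addr0. Qed.

Lemma normsq_eq0 (z : C) : (normsq z == 0) = (z == 0).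
Proof.
by rewrite -(inj_eq (@complexI R)) normsqE mulf_eq0 conjC_eq0 orbb.
Qed.

Lemma normsqM (z w : C) : normsq (z * w) = normsq z * normsq w.
Proof. by apply: complexI; rewrite normsqE !rmorphM /= !normsqE mulrACA. Qed.

Lemma normsq_real (r : R) : normsq r%:C = r ^+ 2.
Proof. by rewrite /normsq /= expr0n addr0. Qed.

Lemma normsqJ (z : C) : normsq (Num.conj z) = normsq z.
Proof. by case: z => x y; rewrite /normsq /= sqrrN. Qed.

Lemma conj_realC (r : R) : Num.conj (r%:C) = r%:C.
Proof. exact: conjc_real. Qed.

Lemma realC_sum (I : Type) (r : seq I) (Q : pred I) (F : I -> R) :
  (\sum_(i <- r | Q i) F i)%:C = \sum_(i <- r | Q i) (F i)%:C.
Proof. exact: (rmorph_sum (real_complex R)). Qed.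

Lemma realC_mul (x y : R) : (x * y)%:C = x%:C * y%:C.
Proof. exact: (rmorphM (real_complex R)). Qed.

Definition vnormsq (d : nat) (x : 'cV[C]_d) : R := \sum_(j < d) normsq (x j 0).

Lemma innerE (d : nat) (x : 'cV[C]_d) : inner x x = (vnormsq x)%:C.
Proof. by rewrite /inner realC_sum; apply: eq_bigr => j _; rewrite normsqE. Qed.

Lemma vnormsq_ge0 (d : nat) (x : 'cV[C]_d) : 0 <= vnormsq x.
Proof. by apply: sumr_ge0 => j _; exact: normsq_ge0. Qed.

Lemma vnormsq_eq0 (d : nat) (x : 'cV[C]_d) : (vnormsq x == 0) = (x == 0).
Proof.
apply/idP/eqP => [|->]; last first.
  by rewrite /vnormsq big1// => j _; rewrite mxE normsq0.
rewrite psumr_eq0 => [/allP x0|j _]; last exact: normsq_ge0.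
apply/matrixP => j l; rewrite ord1 mxE; apply/eqP.
by rewrite -normsq_eq0; apply: x0; rewrite mem_index_enum.
Qed.

Lemma gram_vnormsq (d : nat) (x : 'cV[C]_d) : (x^t* *m x) 0 0 = (vnormsq x)%:C.
Proof.
rewrite mxE /vnormsq realC_sum; apply: eq_bigr => j _.
by rewrite !mxE normsqE mulrC.
Qed.

Lemma adjM (m n p : nat) (A : 'M[C]_(m, n)) (B : 'M[C]_(n, p)) :
  (A *m B)^t* = B^t* *m A^t*.
Proof. by rewrite trmx_mul map_mxM. Qed.

Lemma adj_scale (m n : nat) (z : C) (A : 'M[C]_(m, n)) :
  (z *: A)^t* = Num.conj z *: A^t*.
Proof. by apply/matrixP => i j; rewrite !mxE rmorphM. Qed.

Lemma adjD (m n : nat) (A B : 'M[C]_(m, n)) : (A + B)^t* = A^t* + B^t*.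
Proof. by apply/matrixP => i j; rewrite !mxE rmorphD. Qed.

Lemma unitary_mulmx_adj (d : nat) (U : 'M[C]_d) :
  U \is unitarymx -> (U *m U^t* = 1%:M) * (U^t* *m U = 1%:M).
Proof. by move=> /unitarymxP h; split=> //; exact: mulmx1C. Qed.

Lemma parseval (d : nat) (U : 'M[C]_d) (x : 'cV[C]_d) :
  U \is unitarymx -> vnormsq (U *m x) = vnormsq x.
Proof.
move=> /unitary_mulmx_adj[_ UU]; apply: complexI; rewrite -!gram_vnormsq adjM.
by rewrite mulmxA -[_ *m _ *m U]mulmxA UU mulmx1.
Qed.

Lemma unitary_row_normsq (d : nat) (U : 'M[C]_d) (j : 'I_d) :
  U \is unitarymx -> \sum_(l < d) normsq (U j l) = 1.
Proof.
move=> /unitary_mulmx_adj[UU _]; apply: complexI.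
transitivity ((U *m U^t*) j j); last by rewrite UU mxE eqxx.
by rewrite realC_sum mxE; apply: eq_bigr => l _; rewrite !mxE normsqE.
Qed.

Lemma unitary_col_normsq (d : nat) (U : 'M[C]_d) (l : 'I_d) :
  U \is unitarymx -> \sum_(j < d) normsq (U j l) = 1.
Proof.
move=> /unitary_mulmx_adj[_ UU]; apply: complexI.
transitivity ((U^t* *m U) l l); last by rewrite UU mxE eqxx.
by rewrite realC_sum mxE; apply: eq_bigr => j _; rewrite !mxE normsqE mulrC.
Qed.

Lemma adj_sum (m n : nat) (I : finType) (A : I -> 'M[C]_(m, n)) :
  (\sum_i A i)^t* = \sum_i (A i)^t*.
Proof. by rewrite linear_sum /= map_mx_sum. Qed.

End Coordinates.

Section HermitianEigenvectors.
Variables (R : realType) (d : nat).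
Local Notation C := R[i].
Implicit Types (S : 'M[C]_d) (x y : 'cV[C]_d).

Lemma cauchy_schwarz x y : normsq ((x^t* *m y) 0 0) <= vnormsq x * vnormsq y.
Proof.
have : `|dotmx (x^t*) (y^t*)| ^+ 2 <= dotmx (x^t*) (x^t*) * dotmx (y^t*) (y^t*).
  exact: CauchySchwarz.
by rewrite !dotmxE !trmxCK !gram_vnormsq normCK -normsqE -realC_mul lecR.
Qed.

Lemma rank_one_form x y :
  (x^t* *m rank_one y y *m x) 0 0 = (normsq ((x^t* *m y) 0 0))%:C.
Proof.
have -> : x^t* *m rank_one y y *m x = (x^t* *m y) *m (x^t* *m y)^t*.
  by rewrite /rank_one adjM trmxCK !mulmxA.
by rewrite mxE big_ord1 normsqE; congr (_ * _); rewrite [LHS]mxE [X in X^* = _]mxE.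
Qed.

Lemma eigenvector_orthogonal S x y (al be : R) :
    S^t* = S -> S *m x = al%:C *: x -> S *m y = be%:C *: y -> al != be ->
  y^t* *m x = 0.
Proof.
move=> Sh Sx Sy ab.
have E : al%:C *: (y^t* *m x) = be%:C *: (y^t* *m x).
  by rewrite scalemxAr -Sx mulmxA -{1}Sh -adjM Sy adj_scale conj_realC -scalemxAl.
apply/eqP; move/eqP: E; rewrite -subr_eq0 -scalerBl scaler_eq0 => /orP[|//].
by rewrite subr_eq0 => /eqP/complexI/eqP; rewrite (negPf ab).
Qed.

Lemma vnormsqZ (p : C) (x : 'cV[C]_d) : vnormsq (p *: x) = normsq p * vnormsq x.
Proof. by rewrite /vnormsq mulr_sumr; apply: eq_bigr => j _; rewrite mxE normsqM. Qed.

Lemma vnormsqD (x z : 'cV[C]_d) (p q : C) : z^t* *m x = 0 ->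
  vnormsq (p *: x + q *: z) = normsq p * vnormsq x + normsq q * vnormsq z.
Proof.
move=> zx; have xz : x^t* *m z = 0 by rewrite -[LHS]trmxCK adjM trmxCK zx trmx0 map_mx0.
apply: complexI; rewrite -gram_vnormsq adjD !adj_scale mulmxDr !mulmxDl.
rewrite -!scalemxAl -!scalemxAr zx xz !scaler0 addr0 add0r.
rewrite (rmorphD (real_complex R)) /= !realC_mul -!gram_vnormsq !normsqE !scalerA.
rewrite [LHS]mxE [X in X + _ = _]mxE [X in _ + X = _]mxE.
by congr (_ * _ + _ * _); rewrite mulrC.
Qed.

(** With [p] and [r] the cosine and sine of an angle, [v] splits into the part
    kept by the rotation towards [u] and the part given up. *)
Lemma rank_one_rotate (v u : 'cV[C]_d) (p r : R) (q : C) : p ^+ 2 + r ^+ 2 = 1 ->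
  rank_one (p%:C *: v + q *: u) (p%:C *: v + q *: u) +
    rank_one (r%:C *: v) (r%:C *: v) =
  rank_one v v + (normsq q)%:C *: rank_one u u +
    ((p%:C * Num.conj q) *: (v *m u^t*) + (q * p%:C) *: (u *m v^t*)).
Proof.
move=> pr; rewrite /rank_one adjD !adj_scale !conj_realC mulmxDr !mulmxDl.
rewrite -!scalemxAl -!scalemxAr !scalerA -!realC_mul -!expr2 -normsqE.
have {3}-> : v *m v^t* = (p ^+ 2)%:C *: (v *m v^t*) + (r ^+ 2)%:C *: (v *m v^t*).
  by rewrite -scalerDl -(rmorphD (real_complex R)) /= pr scale1r.
move: (_ *: (v *m v^t*)) (_ *: (v *m v^t*)) (_ *: (u *m v^t*)) => P W Q1.
move: (_ *: (v *m u^t*)) (_ *: (u *m u^t*)) => Q2 U.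
by rewrite -!addrA; congr (_ + _); rewrite !addrA [LHS](ACl (4*3*2*1)).
Qed.

End HermitianEigenvectors.

(** * Frame operators in orthonormal coordinates *)

Section FrameOperator.
Variables (R : realType) (d k : nat).
Local Notation C := R[i].
Implicit Types (g : 'I_k -> 'cV[C]_d) (U : 'M[C]_d).

Lemma frame_form g (x : 'cV[C]_d) :
  (x^t* *m frame_operator g *m x) 0 0 =
  (\sum_(i < k) normsq ((x^t* *m g i) 0 0))%:C.
Proof.
rewrite mulmx_sumr mulmx_suml summxE realC_sum; apply: eq_bigr => i _.
exact: rank_one_form.
Qed.

(** The diagonal of the frame operator in the orthonormal basis of the rows of
    [U]: entry [j] is [<S u_j, u_j>], [u_j] being the conjugate of row [j]. *)
Definition mass U g (j : 'I_d) : R := \sum_(i < k) normsq ((U *m g i) j 0).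

Lemma mass_ge0 U g j : 0 <= mass U g j.
Proof. by apply: sumr_ge0 => i _; exact: normsq_ge0. Qed.

Lemma massE U g j : (U *m frame_operator g *m U^t*) j j = (mass U g j)%:C.
Proof.
rewrite mulmx_sumr mulmx_suml summxE realC_sum; apply: eq_bigr => i _.
by rewrite /rank_one mulmxA -mulmxA -adjM mxE big_ord1 normsqE [X in _ * X]mxE [X in _ * X^*]mxE.
Qed.

Lemma sum_mass U g :
  U \is unitarymx -> \sum_(j < d) mass U g j = \sum_(i < k) vnormsq (g i).
Proof.
move=> Uu; rewrite exchange_big; apply: eq_bigr => i _.
by rewrite -(parseval (g i) Uu).
Qed.

Local Notation P g := (spectralmx (frame_operator g)).
Local Notation s g := (frame_eigenvalue g).

Lemma spectral_frame g :
  P g *m frame_operator g = diag_mx (\row_j (s g j)%:C) *m P g.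
Proof.
have -> : \row_j (s g j)%:C = spectral_diag (frame_operator g).
  by apply/rowP => j; rewrite mxE frame_eigenvalueE.
have /hermitian_normalmx/orthomx_spectralP eqS := frame_operator_hermitian g.
by rewrite [X in P g *m X]eqS !mulmxA mulmxV ?mul1mx// spectral_unit.
Qed.

Lemma spectral_coord g (x : 'cV[C]_d) j :
  (P g *m (frame_operator g *m x)) j 0 = (s g j)%:C * (P g *m x) j 0.
Proof.
by rewrite mulmxA spectral_frame -mulmxA mul_diag_mx !mxE.
Qed.

Lemma spectral_mass g j : mass (P g) g j = s g j.
Proof.
apply: complexI; rewrite -massE spectral_frame -mulmxA.
rewrite (unitary_mulmx_adj (spectral_unitarymx _)).1 mulmx1.
by rewrite !mxE eqxx mulr1n.
Qed.

(** The weights come from a unitary matrix, so the diagonal of a Hermitian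
    matrix is a doubly stochastic image of its spectrum. *)
Lemma mass_spectral U g j :
  mass U g j = \sum_(l < d) normsq ((U *m (P g)^t*) j l) * s g l.
Proof.
apply: complexI; rewrite -massE.
have eqS : frame_operator g = (P g)^t* *m diag_mx (\row_j (s g j)%:C) *m P g.
  rewrite -mulmxA -spectral_frame mulmxA.
  by rewrite (unitary_mulmx_adj (spectral_unitarymx _)).2 mul1mx.
rewrite [X in U *m X]eqS !mulmxA -mulmxA; set W := U *m _.
have -> : P g *m U^t* = W^t* by rewrite adjM trmxCK.
rewrite -/W mxE realC_sum; apply: eq_bigr => l _.
rewrite mul_mx_diag [X in X * _]mxE [X in _ * X * _]mxE [X in _ * X]mxE.
by rewrite [X in _ * X^*]mxE realC_mul normsqE mulrAC.
Qed.

(** Average the supporting line of [f] at [t j] over the eigenvalues of the frame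
    operator with the weights of [mass_spectral], then sum over [j].  The second
    alternative covers a point [t j = 0] at which [f] has no supporting line: if
    the mass there vanishes as well, only the eigenvalue 0 carries weight. *)
Lemma klein (f : R -> R) (U : 'M[C]_d) g (t h : 'I_d -> R) :
    U \is unitarymx ->
    (forall j, (forall y, 0 <= y -> f (t j) + h j * (y - t j) <= f y) \/
               (t j = 0 /\ mass U g j = 0)) ->
  \sum_(j < d) (f (t j) + h j * (mass U g j - t j)) <= convex_potential f g.
Proof.
move=> Uu th; pose W := U *m (P g)^t*.
have Wu : W \is unitarymx.
  by rewrite mul_unitarymx // trmxC_unitary spectral_unitarymx.
have -> : convex_potential f g =
    \sum_(j < d) \sum_(l < d) normsq (W j l) * f (s g l).
  rewrite exchange_big; apply: eq_bigr => l _.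
  by rewrite -mulr_suml unitary_col_normsq// mul1r.
apply: ler_sum => j _.
have -> : f (t j) + h j * (mass U g j - t j) =
    \sum_(l < d) normsq (W j l) * (f (t j) + h j * (s g l - t j)).
  have -> : f (t j) + h j * (mass U g j - t j) =
      \sum_(l < d) normsq (W j l) * (f (t j) - h j * t j) +
      h j * \sum_(l < d) normsq (W j l) * s g l.
    by rewrite -mulr_suml unitary_row_normsq// -mass_spectral; ring.
  by rewrite mulr_sumr -big_split; apply: eq_bigr => l _ /=; ring.
apply: ler_sum => l _; case: (th j) => [sub|[t0 m0]].
  by rewrite ler_wpM2l ?normsq_ge0 ?sub ?frame_eigenvalue_ge0.
(* no supporting line at 0 is needed: all the weight then sits on the kernel *)
have /eqP := m0; rewrite mass_spectral psumr_eq0 => [/allP/(_ l)|l' _]; last first.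
  by rewrite mulr_ge0 ?normsq_ge0 ?frame_eigenvalue_ge0.
rewrite mem_index_enum => /(_ isT) /=; rewrite mulf_eq0 => /orP[/eqP ->|/eqP ->].
  by rewrite !mul0r.
by rewrite t0 subrr mulr0 addr0.
Qed.

End FrameOperator.

(** * Supporting lines of a strictly convex function *)

Section StrictlyConvex.
Variables (R : realType) (f : R -> R).
Hypothesis cvx : strictly_convex_on `[0, +oo[ f.

Let slope x y := (f y - f x) / (y - x).

(** Three-chord inequality. *)
Lemma slope_lt x y z : 0 <= x -> x < y -> y < z -> slope x y < slope y z.
Proof.
move=> x0 xy yz.
have xz : 0 < z - x by rewrite subr_gt0 (lt_trans xy).
have := @cvx x z ((z - y) / (z - x)).
have -> : (z - y) / (z - x) * x + (1 - (z - y) / (z - x)) * z = y.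
  by field; rewrite gt_eqF.
rewrite /= !in_itv /= !andbT => /(_ x0).
have z0 : 0 <= z by rewrite (le_trans x0)// ltW// (lt_trans xy).
have xz' : x != z by rewrite lt_eqF// (lt_trans xy).
have t01 : 0 < (z - y) / (z - x) < 1.
  apply/andP; split; first by apply: divr_gt0 => //; rewrite subr_gt0.
  by rewrite ltr_pdivrMr// mul1r; lra.
move=> /(_ z0 xz' t01).
have -> : (z - y) / (z - x) * f x + (1 - (z - y) / (z - x)) * f z =
  ((z - y) * f x + (y - x) * f z) / (z - x) by field; rewrite gt_eqF.
rewrite ltr_pdivlMr// => H.
rewrite /slope ltr_pdivrMr ?subr_gt0// mulrAC ltr_pdivlMr ?subr_gt0//.
nra.
Qed.

Let sub x := sup [set slope y x | y in [set y | 0 <= y < x]].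

Let sub_ub x z : 0 < x -> x < z ->
  ubound [set slope y x | y in [set y | 0 <= y < x]] (slope x z).
Proof. by move=> x0 xz _ [y /= /andP[y0 yx] <-]; exact/ltW/slope_lt. Qed.

Let sub_le x z : 0 < x -> x < z -> sub x <= slope x z.
Proof.
move=> x0 xz; apply: ge_sup; last exact: sub_ub.
by exists (slope 0 x), 0 => //=; rewrite lexx.
Qed.

Let le_sub x y : 0 <= y -> y < x -> slope y x <= sub x.
Proof.
move=> y0 yx; have x0 := le_lt_trans y0 yx.
apply: ub_le_sup; last by exists y => //=; rewrite y0.
by exists (slope x (x + 1)); apply: sub_ub; rewrite ?ltrDl.
Qed.

(** The slope chosen at [x > 0] is the left derivative, the supremum of the
    slopes of the chords that end at [x]. *)
Lemma subgradient_exists : exists h : R -> R,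
  (forall x y, 0 < x -> 0 <= y -> f x + h x * (y - x) <= f y) /\
  (forall x y, 0 < x -> x < y -> h x < h y).
Proof.
exists sub; split => [x y x0 y0|x y x0 xy].
  case: (ltgtP y x) => [yx|xy|->]; last by rewrite subrr mulr0 addr0.
    have := le_sub y0 yx; rewrite /slope ler_pdivrMr ?subr_gt0//; lra.
  by have := sub_le x0 xy; rewrite /slope ler_pdivlMr ?subr_gt0//; lra.
pose m := (x + y) / 2.
have xm : x < m by rewrite /m; lra.
have my : m < y by rewrite /m; lra.
apply: (le_lt_trans (sub_le x0 xm)); apply: (@lt_le_trans _ _ (slope m y)).
  by apply: slope_lt => //; exact: ltW.
by apply: le_sub => //; lra.
Qed.

(** At 0 no supporting slope may exist; any value below the finitely many other
    slopes keeps the assignment strictly monotone. *)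
Lemma finite_subgradient (n : nat) (t : 'I_n -> R) : (forall j, 0 <= t j) ->
  exists h : 'I_n -> R,
    (forall j y, 0 < t j -> 0 <= y -> f (t j) + h j * (y - t j) <= f y) /\
    (forall i j, t i < t j -> h i < h j).
Proof.
move=> t0; have [h [hsub hmono]] := subgradient_exists.
pose m := - 1 - \sum_j `|h (t j)|.
have mlt j : m < h (t j).
  have : `|h (t j)| <= \sum_j `|h (t j)|.
    by rewrite (bigD1 j)//= lerDl sumr_ge0.
  have := ler_norm (- h (t j)); rewrite normrN /m; lra.
exists (fun j => if 0 < t j then h (t j) else m); split => [j y tj y0|i j tij].
  by rewrite tj; exact: hsub.
rewrite (le_lt_trans (t0 i) tij); case: ifP => // ti; exact: hmono.
Qed.

End StrictlyConvex.

(** * A criterion for strict decrease of the potential *)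

Section Descent.
Variable R : realType.
Local Notation C := R[i].

(** Subtract from [h] its least value on the set where [b] is positive: every
    product becomes nonnegative, and the sum is unchanged because [b] sums to 0. *)
Lemma sum_mul_gt0 (n : nat) (b h : 'I_n -> R) :
    \sum_j b j = 0 -> (exists j, b j != 0) ->
    (forall j l, 0 < b j -> b l < 0 -> h l < h j) ->
  0 < \sum_j h j * b j.
Proof.
move=> b0 [j0 bj0] bh.
have [j1 bj1] : exists j, 0 < b j.
  apply/existsP; rewrite -[X in is_true X]negbK negb_exists; apply/negP => /forallP npos.
  have : \sum_j - b j == 0 by rewrite sumrN b0 oppr0.
  rewrite psumr_eq0 => [/allP/(_ j0)|j _]; last by rewrite oppr_ge0 leNgt.
  by rewrite mem_index_enum oppr_eq0 (negPf bj0) => /(_ isT).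
have [l1 bl1] : exists j, b j < 0.
  apply/existsP; rewrite -[X in is_true X]negbK negb_exists; apply/negP => /forallP nneg.
  have : \sum_j b j == 0 by rewrite b0.
  rewrite psumr_eq0 => [/allP/(_ j0)|j _]; last by rewrite leNgt.
  by rewrite mem_index_enum (negPf bj0) => /(_ isT).
case: (@arg_minP _ R _ j1 (fun j => 0 < b j) h bj1) => m bm hm.
have -> : \sum_j h j * b j = \sum_j (h j - h m) * b j.
  under [RHS]eq_bigr do rewrite mulrBl.
  by rewrite sumrB -mulr_sumr b0 mulr0 subr0.
have ge0 j : 0 <= (h j - h m) * b j.
  case: (ltgtP (b j) 0) => [bj|bj|->]; last by rewrite mulr0.
    by rewrite ltW// nmulr_lgt0// subr_lt0 bh.
  by rewrite mulr_ge0 ?subr_ge0 ?hm// ltW.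
rewrite (bigD1 l1)//=; apply: ltr_wpDr; first by apply: sumr_ge0.
by rewrite nmulr_lgt0// subr_lt0 bh.
Qed.

Variables (d k : nat) (f : R -> R).
Hypothesis cvx : strictly_convex_on `[0, +oo[ f.
Implicit Types g : 'I_k -> 'cV[C]_d.

(** Here [b] is the surplus of [g] over [g'] along the eigenbasis of [g']. *)
Lemma convex_potential_descent g g' :
    let b j := mass (spectralmx (frame_operator g')) g j - frame_eigenvalue g' j in
    \sum_i vnormsq (g i) = \sum_i vnormsq (g' i) ->
    (exists j, b j != 0) ->
    (forall j l, 0 < b j -> b l < 0 ->
      frame_eigenvalue g' l < frame_eigenvalue g' j) ->
    (forall j, frame_eigenvalue g' j = 0 -> b j = 0) ->
  convex_potential f g' < convex_potential f g.
Proof.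
move=> b gg' bn0 bmono bker.
have Uu := spectral_unitarymx (frame_operator g').
have [h [hsub hmono]] := finite_subgradient cvx (frame_eigenvalue_ge0 g').
have hb : 0 < \sum_j h j * b j.
  apply: sum_mul_gt0 => // [|j l bj bl]; last exact/hmono/bmono.
  rewrite sumrB sum_mass//; under [X in _ - X]eq_bigr do rewrite -spectral_mass.
  by rewrite sum_mass// gg' subrr.
have := @klein R d k f _ g (frame_eigenvalue g') h Uu.
rewrite big_split /= -/(convex_potential f g') => kl.
apply: lt_le_trans (kl _); first by rewrite ltrDl.
move=> j; have [t0|tn0] := eqVneq (frame_eigenvalue g' j) 0.
  by right; split => //; have /eqP := bker _ t0; rewrite subr_eq0 t0 => /eqP.
left=> y y0; apply: hsub => //.
by rewrite lt_def tn0 frame_eigenvalue_ge0.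
Qed.

End Descent.

(** * Vectors of a local minimizer are eigenvectors *)

Section RankOneUpdate.
Variables (R : realType) (d k : nat).
Local Notation C := R[i].
Implicit Types (g : 'I_k -> 'cV[C]_d) (v : 'cV[C]_d).

Lemma unitary_coord_inj (U : 'M[C]_d) v w : U \is unitarymx ->
  (forall j, (U *m v) j 0 = (U *m w) j 0) -> v = w.
Proof.
move=> /unitary_mulmx_adj[_ UU] vw; rewrite -[v]mul1mx -[w]mul1mx -UU -!mulmxA.
by congr (_ *m _); apply/matrixP => j l; rewrite ord1.
Qed.

Definition replace_vec g i v : 'I_k -> 'cV[C]_d := fun l => if l == i then v else g l.

Lemma frame_operator_replace g i v :
  frame_operator (replace_vec g i v) = frame_operator (replace_vec g i 0) + rank_one v v.
Proof.
rewrite /frame_operator (bigD1 i)//= [in RHS](bigD1 i)//= /replace_vec eqxx.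
have -> : rank_one 0 0 = 0 :> 'M[C]_d by rewrite /rank_one mul0mx.
rewrite add0r addrC; congr (_ + _).
by apply: eq_bigr => l /negPf ->.
Qed.

Lemma replace_vec_id g i : replace_vec g i (g i) = g.
Proof. by apply/funext => l; rewrite /replace_vec; case: eqP => // ->. Qed.

Lemma rank_one_mul v : rank_one v v *m v = (vnormsq v)%:C *: v.
Proof. by rewrite rank_oneE innerE. Qed.

Lemma mass_replace (U : 'M[C]_d) g i v j :
  mass U g j - mass U (replace_vec g i v) j =
  normsq ((U *m g i) j 0) - normsq ((U *m v) j 0).
Proof.
rewrite /mass (bigD1 i)//= [X in _ - X](bigD1 i)//= /replace_vec eqxx.
rewrite [X in _ - (_ + X)](eq_bigr (fun l => normsq ((U *m g l) j 0))).
  by rewrite opprD addrACA subrr addr0.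
by move=> l /negPf ->.
Qed.

End RankOneUpdate.

Section Criticality.
Variables (R : realType) (d k : nat) (f : R -> R).
Local Notation C := R[i].
Hypothesis cvx : strictly_convex_on `[0, +oo[ f.
Variables (g : 'I_k -> 'cV[C]_d) (e : R).
Hypothesis e0 : 0 < e.
Hypothesis gn0 : forall i, 0 < vnormsq (g i).
Hypothesis gmin : forall g' : 'I_k -> 'cV[C]_d,
  (forall i, vnormsq (g' i) = vnormsq (g i)) ->
  (forall i, vnormsq (g' i - g i) < e) ->
  convex_potential f g <= convex_potential f g'.

(** [v'] is a positive multiple of [(1 + t B)^-1 (g i)], where [B] is the frame
    operator of the other vectors.  In an eigenbasis of [B] the inverse is the
    multiplication by [c j = (1 + t * be j)^-1], so no coordinate grows before
    normalization, and the squared displacement is at most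
    [2 t <B (g i), g i>]. *)
Lemma implicit_step (i : 'I_k) : exists (v' : 'cV[C]_d) (r t : R),
  [/\ 0 < r, 0 < t, t * vnormsq (g i) < 1,
      vnormsq v' = vnormsq (g i) & vnormsq (v' - g i) < e] /\
  r%:C *: g i = v' + t%:C *: (frame_operator (replace_vec g i 0) *m v').
Proof.
set v := g i; set h := replace_vec g i 0; set P := spectralmx (frame_operator h).
have Pu : P \is unitarymx by exact: spectral_unitarymx.
pose be j := frame_eigenvalue h j; have be0 j : 0 <= be j by exact: frame_eigenvalue_ge0.
pose w j := normsq ((P *m v) j 0); have w0 j : 0 <= w j by exact: normsq_ge0.
pose K := \sum_j w j * be j.
have K0 : 0 <= K by apply: sumr_ge0 => j _; rewrite mulr_ge0.
set a := vnormsq v; have a0 : 0 < a by exact: gn0.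
have wa : \sum_j w j = a by rewrite /a -(parseval v Pu).
(* small enough for t * a < 1 and 2 * t * K < e *)
pose t := (2 * a + (2 * K + 1) / e)^-1.
have Ke0 : 0 < (2 * K + 1) / e by apply: divr_gt0 => //; lra.
have t0 : 0 < t by rewrite invr_gt0; lra.
pose c j := (1 + t * be j)^-1.
have bt j : 0 < 1 + t * be j by rewrite ltr_pwDl// mulr_ge0// ltW.
have c0 j : 0 < c j by rewrite invr_gt0.
have c1 j : c j <= 1 by rewrite invf_le1// lerDl mulr_ge0// ltW.
have c2 j : 1 - t * be j <= c j.
  rewrite -[X in _ <= X]mul1r ler_pdivlMr//.
  have : 0 <= (t * be j) ^+ 2 by exact: sqr_ge0.
  nra.
pose N := \sum_j c j ^+ 2 * w j.
have Na : N <= a.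
  rewrite -wa; apply: ler_sum => j _; rewrite ler_piMl//.
  by rewrite expr_le1// ltW.
have N0 : 0 < N.
  have N_ge0 : 0 <= N by apply: sumr_ge0 => j _; rewrite mulr_ge0// sqr_ge0.
  rewrite lt_def N_ge0 andbT; apply/negP => /eqP N0.
  suff : a == 0 by rewrite gt_eqF.
  rewrite -wa big1// => j _; apply/eqP; move/eqP: N0.
  rewrite psumr_eq0 => [/allP/(_ j)|l _]; last by rewrite mulr_ge0// sqr_ge0.
  by rewrite mem_index_enum mulf_eq0 sqrf_eq0 (gt_eqF (c0 j)) => /(_ isT).
pose r := Num.sqrt (a / N).
have r2 : r ^+ 2 = a / N by rewrite sqr_sqrtr// divr_ge0// ltW.
have r0 : 0 < r by rewrite sqrtr_gt0 divr_gt0.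
have r1 : 1 <= r.
  by rewrite -(@ler_pXn2r _ 2)// ?nnegrE ?(ltW r0)// expr1n r2 ler_pdivlMr// mul1r.
pose x : 'cV[C]_d := \col_j ((r * c j)%:C * (P *m v) j 0).
pose v' := P^t* *m x.
have Pv' : P *m v' = x by rewrite mulmxA (unitary_mulmx_adj Pu).1 mul1mx.
exists v', r, t; split; first split => //.
- rewrite /t mulrC ltr_pdivrMr ?mul1r.
    lra.
  by rewrite -invr_gt0.
- rewrite -(parseval _ Pu) Pv' /vnormsq.
  under eq_bigr do rewrite mxE normsqM normsq_real exprMn -mulrA.
  by rewrite -mulr_sumr r2 divfK// gt_eqF.
- rewrite -(parseval _ Pu) mulmxBr Pv' /vnormsq.
  have -> : \sum_j normsq ((x - P *m v) j 0) =
      r ^+ 2 * N + (\sum_j w j - 2 * r * \sum_j c j * w j).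
    rewrite !mulr_sumr -sumrB -big_split; apply: eq_bigr => j _ /=.
    rewrite 2!mxE [X in _ + X]mxE.
    have -> : (r * c j)%:C * (P *m v) j 0 - (P *m v) j 0 =
        (r * c j - 1)%:C * (P *m v) j 0.
      by rewrite -[X in _ - X]mul1r -mulrBl (rmorphB (real_complex R)).
    by rewrite normsqM normsq_real -/(w j); ring.
  rewrite r2 divfK ?gt_eqF// wa.
  have cw : a - t * K <= \sum_j c j * w j.
    rewrite -wa /K mulr_sumr -sumrB; apply: ler_sum => j _.
    by have := ler_wpM2r (w0 j) (c2 j); lra.
  have cw0 : 0 <= \sum_j c j * w j.
    by apply: sumr_ge0 => j _; rewrite mulr_ge0// ltW.
  have tK : t * (2 * K) < e.
    rewrite /t mulrC ltr_pdivrMr; last by rewrite -invr_gt0.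
    have -> : e * (2 * a + (2 * K + 1) / e) = 2 * (a * e) + 2 * K + 1.
      by field; rewrite gt_eqF.
    have : 0 < a * e by rewrite mulr_gt0.
    lra.
  nra.
- apply: (unitary_coord_inj Pu) => j.
  rewrite mulmxDr -!scalemxAr [LHS]mxE [RHS]mxE [X in _ + X]mxE.
  rewrite spectral_coord -/P Pv' [x j 0]mxE -/(be j).
  rewrite !mulrA -!realC_mul -mulrDl -(rmorphD (real_complex R)) /=.
  suff -> : r * c j + t * be j * (r * c j) = r by [].
  by rewrite /c; field; apply: lt0r_neq0; exact: bt.
Qed.

(** With [S' = B + v' v'^*], the equation of the implicit step reads
    [r (g i) = (1 - t a) v' + t S' v'].  Along an eigenvector of [S'] with
    eigenvalue [s] the squared coordinates of [g i] and [v'] thus have the ratio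
    [((1 - t a + t s) / r)^2], which increases with [s]: the surplus is positive
    exactly at the larger eigenvalues.  So it vanishes by minimality, which forces
    [v' = g i], and then the equation itself says that [g i] is an eigenvector. *)
Lemma local_minimizer_eigenvector (i : 'I_k) :
  exists l : R, frame_operator g *m g i = l%:C *: g i.
Proof.
have [v' [r [t [[r0 t0 ta nv' v'e] rv]]]] := implicit_step i.
pose g' := replace_vec g i v'.
have rv' : r%:C *: g i = (1 - t * vnormsq (g i))%:C *: v' + t%:C *: (frame_operator g' *m v').
  rewrite rv [frame_operator g']frame_operator_replace mulmxDl rank_one_mul nv' scalerDr scalerA.
  rewrite addrCA -scalerDl -realC_mul -(rmorphD (real_complex R)) /= subrK scale1r.
  by rewrite addrC.
pose U := spectralmx (frame_operator g'); pose s := frame_eigenvalue g'.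
have Uu : U \is unitarymx by exact: spectral_unitarymx.
have coord j : r%:C * (U *m g i) j 0 = (1 - t * vnormsq (g i) + t * s j)%:C * (U *m v') j 0.
  have := congr1 (fun x => (U *m x) j 0) rv'.
  rewrite /= mulmxDr -!scalemxAr [LHS]mxE => ->.
  rewrite [LHS]mxE [X in X + _]mxE [X in _ + X]mxE spectral_coord.
  rewrite mulrA -realC_mul -mulrDl.
  by rewrite -(rmorphD (real_complex R)).
have s0 j : 0 <= s j by exact: frame_eigenvalue_ge0.
pose m j := 1 - t * vnormsq (g i) + t * s j.
have m0 j : 0 < m j by rewrite ltr_pwDl ?subr_gt0// mulr_ge0// ltW.
have sqcoord j : r ^+ 2 * normsq ((U *m g i) j 0) = m j ^+ 2 * normsq ((U *m v') j 0).
  by rewrite -!normsq_real -!normsqM coord.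
have r20 : 0 < r ^+ 2 by rewrite exprn_gt0.
have [b0|bn0] := boolP [forall j, mass U g j - s j == 0]; last first.
  suff : convex_potential f g' < convex_potential f g.
    rewrite ltNge gmin// => l; rewrite /g' /replace_vec; case: eqP => [->|]//.
    by rewrite subrr /vnormsq big1// => j _; rewrite mxE normsq0.
  have bE j : mass U g j - s j = normsq ((U *m g i) j 0) - normsq ((U *m v') j 0).
    by rewrite /s -spectral_mass -/U mass_replace.
  apply: convex_potential_descent => //.
  - apply: eq_bigr => l _; rewrite /g' /replace_vec; case: eqP => [->|]//.
  - by move: bn0; rewrite negb_forall => /existsP.
  - move=> j l; rewrite -/U -/(s _) -/(s _) !bE subr_gt0 subr_lt0 => bj bl.
    have r_mj : r ^+ 2 < m j ^+ 2.
      rewrite ltNge; apply/negP => /(ler_wpM2r (normsq_ge0 ((U *m v') j 0))).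
      by rewrite -sqcoord ler_pM2l// leNgt bj.
    have ml_r : m l ^+ 2 < r ^+ 2.
      rewrite ltNge; apply/negP => /(ler_wpM2r (normsq_ge0 ((U *m v') l 0))).
      by rewrite -sqcoord ler_pM2l// leNgt bl.
    have := lt_trans ml_r r_mj.
    by rewrite ltr_pXn2r// ?nnegrE ?(ltW (m0 _))// /m ltrD2l ltr_pM2l.
  - move=> j sj; rewrite bE; have /eqP := sj; rewrite -/(s j) -/U in sj *.
    rewrite /s -spectral_mass psumr_eq0 => [/allP/(_ i)|l _]; last exact: normsq_ge0.
    rewrite mem_index_enum /g' /replace_vec eqxx => /(_ isT)/eqP wj.
    have /eqP := sqcoord j; rewrite wj mulr0 mulf_eq0 gt_eqF//= => /eqP ->.
    by rewrite subr0.
have vv' : g i = v'.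
  apply: (unitary_coord_inj Uu) => j.
  have /forallP/(_ j) := b0; rewrite /s -spectral_mass mass_replace subr_eq0 => /eqP bj.
  have := sqcoord j; rewrite -/U in bj; rewrite -bj => /eqP.
  rewrite -subr_eq0 -mulrBl mulf_eq0 subr_eq0 => /orP[|].
    rewrite eqrXn2 ?(ltW (m0 _)) ?(ltW r0)// => /eqP rm.
    have := coord j; rewrite -/(m j) -rm; apply: mulfI.
    by apply/negP => /eqP /(congr1 (@complex.Re _)) /= /eqP; rewrite gt_eqF.
  move=> gj0; have := gj0; rewrite bj !normsq_eq0 => /eqP ->.
  by move: gj0; rewrite normsq_eq0 => /eqP.
rewrite -vv' in rv.
have tC0 : t%:C != 0 by apply/negP => /eqP /(congr1 (@complex.Re _)) /= /eqP; rewrite gt_eqF.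
exists ((r - 1) / t + vnormsq (g i)).
rewrite -{1}(replace_vec_id g i) frame_operator_replace mulmxDl rank_one_mul.
rewrite (rmorphD (real_complex R)) scalerDl; congr (_ + _).
apply: (scalerI tC0); rewrite scalerA -realC_mul.
rewrite [t * _]mulrC divfK ?gt_eqF// (rmorphB (real_complex R)) scalerBl rv.
by rewrite scale1r addrC addKr.
Qed.

End Criticality.

(** * Moving mass between two eigenspaces *)

Section Transfer.
Variables (R : realType) (d k : nat).
Local Notation C := R[i].
Implicit Types g w : 'I_k -> 'cV[C]_d.

Lemma frame_operator_adj g : (frame_operator g)^t* = frame_operator g.
Proof.
by have := is_hermitianmxP _ _ _ (frame_operator_hermitian g); rewrite expr0 scale1r.
Qed.

Definition frame_eigenvector g (j : 'I_d) : 'cV[C]_d :=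
  (spectralmx (frame_operator g))^t* *m delta_mx j 0.

Let Pu g := spectral_unitarymx (frame_operator g).

Lemma spectral_frame_eigenvector g j :
  spectralmx (frame_operator g) *m frame_eigenvector g j = delta_mx j 0.
Proof. by rewrite mulmxA (unitary_mulmx_adj (Pu g)).1 mul1mx. Qed.

Lemma frame_eigenvectorP g j :
  frame_operator g *m frame_eigenvector g j =
  (frame_eigenvalue g j)%:C *: frame_eigenvector g j.
Proof.
apply: (unitary_coord_inj (Pu g)) => l.
rewrite spectral_coord -scalemxAr spectral_frame_eigenvector !mxE.
by case: eqP => [->//|]; rewrite !mulr0.
Qed.

Lemma vnormsq_frame_eigenvector g j : vnormsq (frame_eigenvector g j) = 1.
Proof.
rewrite -(parseval _ (Pu g)) spectral_frame_eigenvector /vnormsq (bigD1 j)//=.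
rewrite big1 ?addr0 => [|l lj]; rewrite !mxE ?(negPf lj) ?normsq0//.
by rewrite !eqxx (normsq_real 1) expr1n.
Qed.

Lemma spectral_coordE g (x : 'cV[C]_d) j :
  (spectralmx (frame_operator g) *m x) j 0 =
  ((frame_eigenvector g j)^t* *m x) 0 0.
Proof.
rewrite adjM trmxCK -mulmxA.
have -> : (delta_mx j 0 : 'cV[C]_d)^t* = delta_mx 0 j.
  by apply/matrixP => a b; rewrite !mxE conjC_nat andbC.
by rewrite -rowE [RHS]mxE.
Qed.

Lemma mass_form g w j :
  (mass (spectralmx (frame_operator g)) w j)%:C =
  ((frame_eigenvector g j)^t* *m frame_operator w *m frame_eigenvector g j) 0 0.
Proof.
by rewrite frame_form; congr (_%:C); apply: eq_bigr => i _; rewrite spectral_coordE.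
Qed.

Variable f : R -> R.
Hypothesis cvx : strictly_convex_on `[0, +oo[ f.

(** The operator [S' = S + de u u^* - D], with [D] the frame operator of [w], is
    obtained from [S] by moving the mass [de] from the eigenspace of [la] to the
    line of [u].  An eigenvector [y] of [S'] not orthogonal to the [w i] gives the
    eigenvector [D y] of [D], with eigenvalue [la - s <= tr D = de]; one not
    orthogonal to [u] has eigenvalue [mu + de], as [S' u = (mu + de) u].  The gap
    condition keeps the two kinds apart, whence the sign pattern required by
    [convex_potential_descent]. *)
Lemma spectral_transfer g g' w (u : 'cV[C]_d) (la mu de : R) :
    0 < de -> 0 <= mu -> mu + de < la - de ->
    vnormsq u = 1 -> \sum_i vnormsq (w i) = de ->
    (forall i, frame_operator g *m w i = la%:C *: w i) ->
    frame_operator g *m u = mu%:C *: u ->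
    frame_operator g + de%:C *: rank_one u u = frame_operator g' + frame_operator w ->
    \sum_i vnormsq (g i) = \sum_i vnormsq (g' i) ->
  convex_potential f g' < convex_potential f g.
Proof.
move=> de0 mu0 gap u1 wde Sw Su SS gg'.
set S := frame_operator g in Sw Su SS *; set S' := frame_operator g' in SS *.
set D := frame_operator w in SS *.
have lamu : la != mu by rewrite gt_eqF//; lra.
have uw i : u^t* *m w i = 0.
  by apply: (eigenvector_orthogonal (frame_operator_adj g) (Sw i) Su).
have wu i : (w i)^t* *m u = 0.
  by apply: (eigenvector_orthogonal (frame_operator_adj g) Su (Sw i)); rewrite eq_sym.
have Du : D *m u = 0.
  rewrite mulmx_suml big1// => i _.
  by rewrite /rank_one -mulmxA wu mulmx0.
have uD : u^t* *m D = 0 by rewrite -[D]frame_operator_adj -adjM Du trmx0 map_mx0.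
have SD : S *m D = la%:C *: D.
  rewrite mulmx_sumr scaler_sumr; apply: eq_bigr => i _.
  by rewrite /rank_one mulmxA Sw scalemxAl.
have S'E : S' = S + de%:C *: rank_one u u - D by rewrite SS addrK.
have S'u : S' *m u = (mu + de)%:C *: u.
  rewrite S'E mulmxBl mulmxDl Su Du subr0 -scalemxAl rank_one_mul u1 scale1r.
  by rewrite -scalerDl -(rmorphD (real_complex R)).
have S'D : S' *m D = la%:C *: D - D *m D.
  rewrite S'E mulmxBl mulmxDl SD -scalemxAl /rank_one -[u *m _ *m D]mulmxA uD.
  by rewrite mulmx0 scaler0 addr0.
have DS' : D *m S' = la%:C *: D - D *m D.
  rewrite -[LHS]trmxCK adjM !frame_operator_adj S'D.
  rewrite -scaleN1r adjD !adj_scale adjM frame_operator_adj conj_realC.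
  by rewrite rmorphN rmorph1.
pose y j := frame_eigenvector g' j; pose s j := frame_eigenvalue g' j.
pose U := spectralmx S'.
have Uu : U \is unitarymx by exact: spectral_unitarymx.
pose A j := mass U w j; pose B j := de * normsq ((U *m u) j 0).
have A0 j : 0 <= A j by exact: mass_ge0.
have B0 j : 0 <= B j by rewrite mulr_ge0 ?normsq_ge0// ltW.
have bE j : mass U g j - s j = A j - B j.
  have : (mass U g j)%:C + (B j)%:C = (s j)%:C + (A j)%:C.
    rewrite /s -spectral_mass !mass_form.
    have := congr1 (fun M => ((y j)^t* *m M *m y j) 0 0) SS.
    rewrite /= !mulmxDr !mulmxDl [LHS]mxE [RHS]mxE -scalemxAr -scalemxAl.
    rewrite [X in _ + X = _]mxE => <-; congr (_ + _).
    by rewrite /B realC_mul spectral_coordE rank_one_form.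
  by move=> /(congr1 (@complex.Re _)) /=; lra.
have sA j : A j != 0 -> la - de <= s j.
  move=> Aj; pose x := D *m y j.
  have x0 : 0 < vnormsq x.
    rewrite lt_def vnormsq_ge0 andbT vnormsq_eq0; apply: contra Aj => /eqP x0.
    by rewrite -(inj_eq (@complexI R)) mass_form -mulmxA -/(y j) -/D -/x x0 mulmx0 mxE.
  have Dx : D *m x = (la - s j)%:C *: x.
    have : D *m (S' *m y j) = (s j)%:C *: x by rewrite frame_eigenvectorP -scalemxAr.
    rewrite mulmxA DS' mulmxBl -scalemxAl -mulmxA -/x => E.
    by rewrite (rmorphB (real_complex R)) scalerBl -E opprB addrC subrK.
  suff : (la - s j) * vnormsq x <= de * vnormsq x by rewrite ler_pM2r//; lra.
  have -> : (la - s j) * vnormsq x = \sum_i normsq ((x^t* *m w i) 0 0).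
    apply: complexI; rewrite -frame_form -mulmxA Dx -scalemxAr mxE gram_vnormsq.
    exact: realC_mul.
  rewrite -wde mulr_suml; apply: ler_sum => i _; rewrite mulrC.
  exact: cauchy_schwarz.
have sB j : B j != 0 -> s j = mu + de.
  move=> Bj; apply/eqP; apply: contraNT Bj => sj.
  rewrite /B spectral_coordE (eigenvector_orthogonal (frame_operator_adj g') S'u
    (frame_eigenvectorP g' j)) 1?eq_sym// mxE normsq0 mulr0//.
have sumB : \sum_j B j = de by rewrite -mulr_sumr -/(vnormsq _) parseval// u1 mulr1.
have AB j : A j = 0 \/ B j = 0.
  have [->|/sA sj] := eqVneq (A j) 0; first by left.
  have [->|/sB sj'] := eqVneq (B j) 0; first by right.
  by move: sj; rewrite sj' leNgt gap.
apply: convex_potential_descent => //.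
- rewrite -/U; apply/existsP; rewrite -[X in is_true X]negbK negb_exists.
  apply/negP => /forallP b0; suff : de == 0 by rewrite gt_eqF.
  rewrite -sumB big1// => j _; have := b0 j; rewrite negbK bE.
  by case: (AB j) => -> //; rewrite sub0r oppr_eq0 => /eqP.
- move=> j l; rewrite -/U -!/(s _) !bE => bj bl.
  have Aj : A j != 0 by rewrite gt_eqF//; have := B0 j; lra.
  have Bl : B l != 0 by rewrite gt_eqF//; have := A0 l; lra.
  by rewrite (sB _ Bl); apply: lt_le_trans gap _; exact: sA.
- move=> j; rewrite -/U -!/(s _) bE => sj.
  have [->|/sA] := eqVneq (A j) 0; last by rewrite sj; lra.
  have [->|/sB] := eqVneq (B j) 0; first by rewrite subrr.
  by rewrite sj; lra.
Qed.

End Transfer.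

(** * Vectors outside the bottom eigenspace are not redundant *)

Section HalfRoot.
Variable R : realType.

(** The larger root of [x (1 - x) = y], used as the squared cosine of a small
    rotation angle. *)
Lemma half_root_bounds (y : R) : 0 <= y -> 4 * y <= 1 ->
  let x := (1 + Num.sqrt (1 - 4 * y)) / 2 in
  [/\ 0 < x, x <= 1, x * (1 - x) = y & 1 - x <= 2 * y].
Proof.
move=> y0 y1; set q := Num.sqrt _ => /=; rewrite -/q.
have q2 : q ^+ 2 = 1 - 4 * y by rewrite sqr_sqrtr// subr_ge0.
have q0 : 0 <= q by exact: sqrtr_ge0.
by split; nra.
Qed.

End HalfRoot.

Section Redundancy.
Variables (R : realType) (d k : nat) (f : R -> R).
Local Notation C := R[i].
Hypothesis cvx : strictly_convex_on `[0, +oo[ f.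
Variables (g : 'I_k -> 'cV[C]_d) (e : R).
Hypothesis e0 : 0 < e.
Hypothesis gn0 : forall i, 0 < vnormsq (g i).
Hypothesis gmin : forall g' : 'I_k -> 'cV[C]_d,
  (forall i, vnormsq (g' i) = vnormsq (g i)) ->
  (forall i, vnormsq (g' i - g i) < e) ->
  convex_potential f g <= convex_potential f g'.
Variable lam : 'I_k -> R.
Hypothesis glam : forall i, frame_operator g *m g i = (lam i)%:C *: g i.

(** Coefficients of the linear relation obtained by expanding
    [S (g i) - lam i (g i) = 0] on the family [g]. *)
Definition relation_coef (i l : 'I_k) : C :=
  ((g l)^t* *m g i) 0 0 - (if l == i then (lam i)%:C else 0).

Lemma relation_sum i : \sum_l relation_coef i l *: g l = 0.
Proof.
under eq_bigr do rewrite scalerBl.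
rewrite sumrB [X in _ - X](bigD1 i)//= eqxx [X in _ - (_ + X)]big1 ?addr0.
  rewrite -glam mulmx_suml; apply/eqP; rewrite subr_eq0; apply/eqP.
  apply: eq_bigr => l _; rewrite rank_oneE; congr (_ *: _).
  by rewrite mxE; apply: eq_bigr => j _; rewrite !mxE mulrC.
by move=> l /negPf ->; rewrite scale0r.
Qed.

(** Eigenvectors for different eigenvalues are orthogonal, so the relation only
    involves the eigenspace of [g i]. *)
Lemma relation_coef_eigen i l : relation_coef i l != 0 -> lam l = lam i.
Proof.
rewrite /relation_coef; have [->//|li] := eqVneq l i; rewrite subr0.
apply: contraNeq => ll; rewrite (eigenvector_orthogonal (frame_operator_adj g)
  (glam i) (glam l)) 1?eq_sym// mxE.
by [].
Qed.

(** The relation is nontrivial, its coefficient at [g i] being [a i - lam i].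
    Rotate each [g l] to [p_l g_l + q_l u] with [p_l conj(q_l) = ep cf_l]: the
    cross terms add up to [ep] times the relation, that is to 0. *)
Lemma local_minimizer_big i j0 : frame_eigenvalue g j0 < lam i ->
  vnormsq (g i) = lam i.
Proof.
set mu := frame_eigenvalue g j0 => mulam; apply/eqP; apply: contraT => ai.
set u := frame_eigenvector g j0.
have u1 : vnormsq u = 1 by exact: vnormsq_frame_eigenvector.
have Su : frame_operator g *m u = mu%:C *: u by exact: frame_eigenvectorP.
pose cf := relation_coef i; pose ga l := normsq (cf l).
pose Ga := \sum_l ga l.
have ga0 l : 0 <= ga l by exact: normsq_ge0.
have cfi : ga i != 0.
  rewrite normsq_eq0 /cf /relation_coef eqxx gram_vnormsq.
  rewrite -(rmorphB (real_complex R)) /=; apply: contra ai => /eqP.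
  by move=> /(congr1 (@complex.Re _)) /= /eqP; rewrite subr_eq0.
have gaGa l : ga l <= Ga by rewrite /Ga (bigD1 l)//= lerDl sumr_ge0.
have Ga0 : 0 < Ga by apply: lt_le_trans (gaGa i); rewrite lt_def cfi ga0.
pose a l := vnormsq (g l).
pose M := \sum_l ga l / a l.
have gaM l : ga l / a l <= M.
  by rewrite /M (bigD1 l)//= lerDl sumr_ge0// => l' _; rewrite divr_ge0// ltW// gn0.
have M0 : 0 <= M by apply: sumr_ge0 => l _; rewrite divr_ge0// ltW// gn0.
pose K := 4 * (Ga / e) + 4 * (Ga / (lam i - mu)) + 4 * M.
have gap : 0 < lam i - mu by rewrite subr_gt0.
have K1 : 0 < Ga / e by exact: divr_gt0.
have K2 : 0 < Ga / (lam i - mu) by exact: divr_gt0.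
have K0 : 0 < K by rewrite /K; lra.
(* small enough for every vector to stay within e, for the transferred mass to
   be less than half of the gap, and for the angles to exist: 4 * y l <= 1 *)
pose eta := (K + 1)^-1.
have eta0 : 0 < eta by rewrite invr_gt0; lra.
have etaK z : z < K + 1 -> eta * z < 1.
  by move=> zK; rewrite /eta mulrC ltr_pdivrMr ?mul1r//; lra.
have eta1 : eta * (4 * Ga) < e.
  rewrite -[ltRHS]mul1r -ltr_pdivrMr// -mulrA etaK// -mulrA /K; lra.
have eta2 : eta * (4 * Ga) < lam i - mu.
  rewrite -[ltRHS]mul1r -ltr_pdivrMr// -mulrA etaK// -mulrA /K; lra.
pose y l := eta * (ga l / a l).
have y0 l : 0 <= y l by rewrite mulr_ge0 ?divr_ge0// ltW// gn0.
have y1 l : 4 * y l <= 1.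
  by rewrite /y mulrCA ltW// etaK// /K; have := gaM l; lra.
pose x l := (1 + Num.sqrt (1 - 4 * y l)) / 2.
have x0 l : 0 < x l by have [] := half_root_bounds (y0 l) (y1 l).
have x1 l : x l <= 1 by have [] := half_root_bounds (y0 l) (y1 l).
have xx l : x l * (1 - x l) = y l by have [] := half_root_bounds (y0 l) (y1 l).
have xy l : 1 - x l <= 2 * y l by have [] := half_root_bounds (y0 l) (y1 l).
have ya l : y l * a l = eta * ga l by rewrite /y mulrA divfK// gt_eqF// gn0.
pose p l := Num.sqrt (x l).
have p2 l : p l ^+ 2 = x l by rewrite sqr_sqrtr// ltW.
have p0 l : 0 < p l by rewrite sqrtr_gt0.
pose ep := Num.sqrt eta.
have ep2 : ep ^+ 2 = eta by rewrite sqr_sqrtr// ltW.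
pose q l : C := (ep / p l)%:C * Num.conj (cf l).
have q2 l : normsq (q l) = (1 - x l) * a l.
  rewrite normsqM normsq_real normsqJ exprMn exprVn ep2 p2 -/(ga l).
  rewrite mulrAC -ya -xx; field; exact: lt0r_neq0.
have cf0 l : lam l != lam i -> cf l = 0.
  by move=> ll; apply/eqP; apply: contraNT ll => /relation_coef_eigen ->.
have x_eq1 l : cf l = 0 -> x l = 1.
  move=> c0; rewrite /x /y /ga c0 normsq0 mul0r !mulr0 subr0 sqrtr1; lra.
have gorth l : cf l != 0 -> u^t* *m g l = 0.
  move=> cl; apply: (eigenvector_orthogonal (frame_operator_adj g) (glam l) Su).
  by rewrite (relation_coef_eigen cl) gt_eqF.
have normD l (r : C) : vnormsq (r *: g l + q l *: u) = normsq r * a l + normsq (q l).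
  have [c0|cl] := eqVneq (cf l) 0.
    by rewrite /q c0 conjC0 mulr0 scale0r !normsq0 !addr0 /a vnormsqZ.
  by rewrite vnormsqD ?gorth// u1 mulr1.
pose g' l := (p l)%:C *: g l + q l *: u.
pose w l := (Num.sqrt (1 - x l))%:C *: g l.
have ng' l : vnormsq (g' l) = a l.
  by rewrite normD normsq_real p2 q2; ring.
suff : convex_potential f g' < convex_potential f g.
  rewrite ltNge gmin// => l.
  have -> : g' l - g l = ((p l - 1)%:C) *: g l + q l *: u.
    by rewrite /g' addrAC (rmorphB (real_complex R)) scalerBl scale1r.
  rewrite normD normsq_real q2.
  have p1 : p l <= 1.
    by rewrite -(@ler_pXn2r _ 2)// ?nnegrE ?(ltW (p0 l))// p2 expr1n.
  have pp : (p l - 1) ^+ 2 <= 1 - x l.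
    by rewrite -p2; have := p0 l; nra.
  have al : 0 < a l by exact: gn0.
  have := ler_wpM2r (ltW al) pp; have := ler_wpM2r (ltW al) (xy l).
  have : eta * ga l <= eta * Ga by rewrite ler_pM2l.
  by rewrite -ya; lra.
pose de := \sum_l (1 - x l) * a l.
have de_le : de <= 2 * (eta * Ga).
  rewrite /de /Ga !mulr_sumr; apply: ler_sum => l _.
  by rewrite -ya mulrA; apply: ler_wpM2r (xy l); rewrite ltW// gn0.
have xn0 l : 0 <= (1 - x l) * a l by rewrite mulr_ge0 ?subr_ge0// ltW// gn0.
apply: (spectral_transfer cvx (w := w) (u := u) (la := lam i) (mu := mu) (de := de)) => //.
- rewrite /de (bigD1 i)//=; apply: ltr_wpDr; first by apply: sumr_ge0.
  rewrite mulr_gt0 ?gn0// lt_def subr_ge0 x1 andbT.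
  apply: contraNneq cfi => xi; have := ya i; rewrite -xx xi mulr0 mul0r.
  by move=> /esym/eqP; rewrite mulf_eq0 (gt_eqF eta0).
- exact: frame_eigenvalue_ge0.
- lra.
- apply: eq_bigr => l _.
  by rewrite vnormsqZ normsq_real sqr_sqrtr// subr_ge0.
- move=> l; rewrite /w -scalemxAr glam scalerA scalerA.
  have [->|/cf0/x_eq1 ->] := eqVneq (lam l) (lam i); first by rewrite mulrC.
  by rewrite subrr sqrtr0 mul0r mulr0.
- have cross l : (p l)%:C * Num.conj (q l) = ep%:C * cf l.
    rewrite /q rmorphM /= conj_realC conjCK mulrA -realC_mul; congr (_ * _).
    by rewrite mulrCA divff ?mulr1// gt_eqF.
  have cross' l : q l * (p l)%:C = ep%:C * Num.conj (cf l).
    by rewrite /q mulrAC -realC_mul divfK// gt_eqF.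
  have R0 : \sum_l cf l *: g l = 0 by exact: relation_sum.
  have R0' : \sum_l Num.conj (cf l) *: (g l)^t* = 0.
    under eq_bigr do rewrite -adj_scale.
    by rewrite -adj_sum R0 trmx0 map_mx0.
  have term l : rank_one (g' l) (g' l) + rank_one (w l) (w l) =
      rank_one (g l) (g l) + ((1 - x l) * a l)%:C *: rank_one u u
      + ep%:C *: ((cf l *: g l) *m u^t* + u *m (Num.conj (cf l) *: (g l)^t*)).
    rewrite rank_one_rotate ?p2 ?sqr_sqrtr ?subr_ge0 ?[x l + _]addrC ?subrK//.
    by rewrite cross cross' q2 scalerDr -scalemxAl -scalemxAr !scalerA.
  rewrite /frame_operator -big_split /=.
  under [RHS]eq_bigr do rewrite term.
  rewrite 2!big_split /= -scaler_sumr big_split /= -mulmx_suml -mulmx_sumr R0 R0'.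
  by rewrite mul0mx mulmx0 addr0 scaler0 addr0 -scaler_suml -realC_sum.
- by apply: eq_bigr => l _.
Qed.
End Redundancy.

(** * Neighbourhoods in the product topology *)

Section LocalMin.
Variables (R : realType) (d k : nat) (a : 'I_k -> R).
Local Notation C := R[i].

(** The sets [B e] generate a filter that converges to [g] in the product
    topology, as it does in each entry of each vector. *)
Lemma local_minimizer_vnormsq (F : {ptws 'I_k -> 'cV[C]_d} -> R)
    (g : {ptws 'I_k -> 'cV[C]_d}) :
    is_local_minimizer (prescribed_norms a) F g ->
  exists2 e : R, 0 < e & forall g' : {ptws 'I_k -> 'cV[C]_d},
    prescribed_norms a g' -> (forall i, vnormsq (g' i - g i) < e) -> F g <= F g'.
Proof.
move=> [_ gmin].
pose B (e : R) := [set g' : {ptws 'I_k -> 'cV[C]_d} | forall i, vnormsq (g' i - g i) < e].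
pose G := filter_from [set e : R | 0 < e] B.
have GF : Filter G.
  apply: filter_from_filter; first by exists 1 => /=.
  move=> e1 e2 /= e10 e20; exists (Num.min e1 e2); first by rewrite lt_min e10.
  by move=> g' Bg'; split=> i; have := Bg' i; rewrite lt_min => /andP[].
have Gg : G --> g.
  apply/cvg_sup => i.
  apply/cvg_image; first by rewrite eqEsubset; split=> v // _; exists (fun _ => v).
  move=> A /= [Q nQ QA].
  have GQ (j : 'I_d) : G [set g' | Q j 0 (g' i j 0)].
    have /nbhs_ballP[e /= e0 eQ] := nQ j 0.
    have eE : e = (complex.Re e)%:C by rewrite RRe_real// gtr0_real.
    have re0 : 0 < complex.Re e by rewrite -ltcR -eE.
    exists (complex.Re e ^+ 2); first by rewrite /= exprn_gt0.
    move=> g' /(_ i) g'e; apply: eQ; rewrite -ball_normE /= -normrN opprB.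
    suff : Num.norm (g' i j 0 - g i j 0) < e by [].
    rewrite eE -(@ltr_pXn2r _ 2)// ?nnegrE ?normr_ge0 ?ler0c ?(ltW re0)//.
    rewrite -add_Re2_Im2 -(rmorphXn (real_complex R)) ltcR.
    apply: le_lt_trans g'e; rewrite /vnormsq (bigD1 j)//= !mxE lerDl.
    by apply: sumr_ge0 => l _; exact: normsq_ge0.
  suff : exists2 B, G B & [set g' i | g' in B] = A by [].
  exists [set g' | A (g' i)].
    have := @filter_forall _ _ _ G GF GQ; apply: filterS => g' g'Q /=.
    by apply: QA => /= j l; rewrite ord1; exact: g'Q.
  rewrite eqEsubset; split => [_ [g' g'A <-]//|v Av].
  by exists (fun _ => v).
have [e /= e0 Be] : G [set g' | prescribed_norms a g' -> F g <= F g'].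
  exact: Gg gmin.
by exists e => // g' ag' g'e; exact: Be.
Qed.
End LocalMin.

(** * The spectrum of a local minimizer and its optimality *)

Section Spectrum.
Variables (R : realType) (d k : nat).
Local Notation C := R[i].
Hypothesis hkd : (d <= k)%N.
Variable a : 'I_k -> R.
Hypothesis a0 : forall i, 0 < a i.
Hypothesis a_mono : forall i j : 'I_k, (i <= j)%N -> a j <= a i.
Implicit Types g : 'I_k -> 'cV[C]_d.

(** Let [n i l] be the squared modulus of coordinate [l] of [g i] in an
    eigenbasis.  Its sums over [l] are the [a i], its sums over [i] are the
    eigenvalues, and [n i l] vanishes unless [g i] belongs to the eigenvalue [l].
    A vector at the least eigenvalue [c] has [a i <= c]; at a larger one, [a i] is
    the eigenvalue.  So [n i l / a i], restricted to the eigenvalues above [c], is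
    doubly stochastic and links only equal values: both sides have the same sums
    [sum (F - F c)].  Taking for [F] the indicator of [x > c] counts the [a i > c]:
    they are fewer than [d], as [c] is an eigenvalue, whereas for [c = 0] they
    would be all [k >= d] of them. *)
Lemma water_filling_spectrum g (lam : 'I_k -> R) (d0 : (0 < d)%N) :
    (forall i, vnormsq (g i) = a i) ->
    (forall i, frame_operator g *m g i = (lam i)%:C *: g i) ->
    (forall i j, frame_eigenvalue g j < lam i -> a i = lam i) ->
  exists2 c : R, 0 < c & forall F : R -> R,
    \sum_(j < d) F (frame_eigenvalue g j) =
    \sum_(j < d) F (Num.max (a (widen_ord hkd j)) c).
Proof.
move=> ga glam gbig; pose s := frame_eigenvalue g.
have Pu := spectral_unitarymx (frame_operator g).
pose n i l := normsq ((spectralmx (frame_operator g) *m g i) l 0).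
have n0 i l : 0 <= n i l by exact: normsq_ge0.
have na i : \sum_l n i l = a i by rewrite -ga -(parseval _ Pu).
have ns l : \sum_i n i l = s l by exact: spectral_mass.
have nlam i l : n i l != 0 -> lam i = s l.
  have := spectral_coord g (g i) l; rewrite glam -scalemxAr mxE => /eqP.
  rewrite -subr_eq0 -mulrBl mulf_eq0 subr_eq0 normsq_eq0 => /orP[/eqP/complexI//|->//].
pose c := s [arg min_(j < Ordinal d0) s j]%O.
have [j0 cE cmin] : exists2 j0, c = s j0 & forall j, c <= s j.
  by rewrite /c; case: arg_minP => // j _ jmin; exists j => // l; exact: jmin.
have lam_c i : c <= lam i.
  have [l nil] : exists l, n i l != 0.
    apply/existsP; rewrite -[X in is_true X]negbK negb_exists; apply/negP => /forallP z.
    have := a0 i; rewrite -na big1 ?ltxx// => l _; apply/eqP; rewrite -[_ == _]negbK; exact: z.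
  by rewrite (nlam _ _ nil).
have a_lam i : a i <= lam i.
  rewrite -(ler_pM2l (a0 i)).
  have -> : a i * lam i = \sum_l normsq (((g i)^t* *m g l) 0 0).
    apply: complexI; rewrite -frame_form -mulmxA glam -scalemxAr mxE gram_vnormsq ga.
    by rewrite realC_mul mulrC.
  rewrite (bigD1 i)//= gram_vnormsq ga normsq_real -expr2 lerDl.
  by apply: sumr_ge0 => l _; exact: normsq_ge0.
have a_big i : c < lam i -> a i = lam i by rewrite cE => /gbig.
have a_small i : ~~ (c < lam i) -> Num.max (a i) c = c.
  by rewrite -leNgt => lc; apply/max_idPr; exact: le_trans (a_lam i) lc.
have sumF (F : R -> R) :
    \sum_l (F (s l) - F c) = \sum_i (F (Num.max (a i) c) - F c).
  have -> : \sum_i (F (Num.max (a i) c) - F c) =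
      \sum_i \sum_l n i l * ((F (Num.max (a i) c) - F c) / a i).
    by apply: eq_bigr => i _; rewrite -mulr_suml na mulrC divfK// gt_eqF.
  rewrite exchange_big; apply: eq_bigr => l _ /=.
  have [sc|sc] := eqVneq (s l) c.
    rewrite sc subrr big1// => i _; have [->|/nlam li] := eqVneq (n i l) 0.
      by rewrite mul0r.
    by rewrite a_small ?subrr ?mul0r ?mulr0// li sc ltxx.
  have cs : c < s l by rewrite lt_def sc cmin.
  rewrite (eq_bigr (fun i => n i l * ((F (s l) - F c) / s l))).
    rewrite -mulr_suml ns mulrC divfK//; apply/negP => /eqP sl0.
    have := frame_eigenvalue_ge0 g j0; rewrite -/(s j0) -cE leNgt -sl0 cs//.
  move=> i _; have [->|/nlam li] := eqVneq (n i l) 0; first by rewrite !mul0r.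
  have ali : a i = s l by rewrite -li; apply: a_big; rewrite li.
  by rewrite ali (max_idPl _)// ltW.
have card_big i : c < a i -> (i.+1 < d)%N.
  move=> ci; pose chi (x : R) : R := if (c < x)%R then 1 else 0.
  have chi_ge0 x : 0 <= chi x by rewrite /chi; case: ifP.
  have chi_le1 x : chi x <= 1 by rewrite /chi; case: ifP.
  have := sumF chi; have chic : chi c = 0 by rewrite /chi ltxx.
  rewrite !sumrB chic !sumr_const !mul0rn !subr0 => chiE.
  have up : \sum_l chi (s l) < d%:R.
    have -> : d%:R = \sum_(l < d) (1 : R) by rewrite sumr_const card_ord.
    rewrite (bigD1 j0)//= [ltRHS](bigD1 j0)//= -cE chic add0r.
    apply: (@le_lt_trans _ _ (\sum_(l < d | l != j0) 1)); first exact: ler_sum.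
    by rewrite ltrDr.
  have low : (i.+1)%:R <= \sum_i chi (Num.max (a i) c).
    have -> : (i.+1)%:R = \sum_(j < k | (j < i.+1)%N) (1 : R).
      by rewrite (big_ord_narrow (ltn_ord i)) sumr_const card_ord.
    rewrite [leRHS](bigID (fun j : 'I_k => (j < i.+1)%N))/=.
    rewrite -[leLHS]addr0; apply: lerD; last exact: sumr_ge0.
    apply: ler_sum => j ji; rewrite /chi lt_max (lt_le_trans ci)//.
    exact: a_mono.
  by rewrite -(ltr_nat R); apply: le_lt_trans low _; rewrite -chiE.
exists c => [|F].
  rewrite ltNge; apply/negP => c0.
  have k0 : (k.-1 < k)%N by rewrite prednK// (leq_trans d0).
  have /card_big /= := le_lt_trans c0 (a0 (Ordinal k0)).
  by rewrite prednK ?(leq_trans d0)// ltnNge hkd.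
apply: (addIr (- \sum_(j < d) F c)); rewrite -!sumrB -/s sumF.
rewrite (bigID (fun i : 'I_k => (i < d)%N))/= [X in _ + X]big1 ?addr0.
  by rewrite (big_ord_narrow hkd).
move=> i id; rewrite (max_idPr _) ?subrr// leNgt; apply: contra id => /card_big.
exact: ltnW.
Qed.

(** Vector [i] lies in the span of the first [i + 1] rows of its Gram-Schmidt
    basis. *)
Lemma schmidt_triangular g (i j : 'I_d) : (i < j)%N ->
  (schmidt (\matrix_(i < d) (g (widen_ord hkd i))^t*) *m
    g (widen_ord hkd i)) j 0 = 0.
Proof.
set A := \matrix_i _; set U := schmidt A => ij.
have UU : U *m U^t* = 1%:M by apply/unitarymxP; exact: schmidt_unitarymx.
have Uij : row i A *m (row j U)^t* = 0.
  apply/sub_kermxP; apply: submx_trans (row_schmidt_sub A i) _.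
  apply/sumsmx_subP => l li.
  rewrite genmxE; apply/sub_kermxP; apply/matrixP => p q; rewrite !ord1.
  transitivity ((U *m U^t*) l j).
    by rewrite !mxE; apply: eq_bigr => r _; rewrite !mxE.
  rewrite UU !mxE (_ : l == j = false)//.
  by apply/negbTE; rewrite neq_ltn (leq_ltn_trans li).
have := congr1 (fun M => (M^t*) 0 0) Uij.
rewrite adjM trmxCK /A rowK trmxCK trmx0 map_mx0 [RHS]mxE => <-.
by rewrite -row_mul [RHS]mxE.
Qed.

Variable f : R -> R.
Hypothesis cvx : strictly_convex_on `[0, +oo[ f.

(** Write [n i j] for the squared coordinates of [g'] in the Gram-Schmidt basis
    and [e j = h (t j) - h c >= 0], which is nonincreasing in [j].  The traces agree,
    so the slopes may be shifted by [h c], and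
      sum_j e_j (mass j) >= sum_(i < d) sum_(j <= i) e_j (n i j)
                         >= sum_(i < d) e_i a_i = sum_i e_i t_i,
    the last step because [e i = 0] unless [t i = a i]. *)
Lemma water_filling_optimal g g' (c : R) : 0 < c ->
    (forall i, vnormsq (g i) = a i) -> (forall i, vnormsq (g' i) = a i) ->
    (forall F : R -> R, \sum_(j < d) F (frame_eigenvalue g j) =
      \sum_(j < d) F (Num.max (a (widen_ord hkd j)) c)) ->
  convex_potential f g <= convex_potential f g'.
Proof.
move=> c0 ga ga' gF; pose al j := a (widen_ord hkd j).
pose t j := Num.max (al j) c; pose U := schmidt (\matrix_(i < d) (g' (widen_ord hkd i))^t*).
have Uu : U \is unitarymx by exact: schmidt_unitarymx.
have t0 j : 0 < t j by rewrite lt_max c0 orbT.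
have [h [hsub hmono]] := subgradient_exists cvx.
have h_le x y : 0 < x -> x <= y -> h x <= h y.
  by move=> x0; rewrite le_eqVlt => /orP[/eqP -> //|/hmono h_xy]; exact/ltW/h_xy.
have := @klein R d k f U g' t (h \o t) Uu.
rewrite big_split /= /convex_potential gF -/t => kl.
apply: le_trans (kl _); last by move=> j; left=> y y0; exact: hsub.
rewrite lerDl; pose b j := mass U g' j - t j; pose e j := h (t j) - h c.
have trace : \sum_j mass U g' j = \sum_j t j.
  rewrite sum_mass// -(gF id) /=.
  under [RHS]eq_bigr do rewrite -spectral_mass.
  rewrite sum_mass ?spectral_unitarymx//.
  by apply: eq_bigr => i _; rewrite ga ga'.
have -> : \sum_j h (t j) * b j = \sum_j e j * mass U g' j - \sum_j e j * t j.
  have b0 : \sum_j b j = 0 by rewrite sumrB trace subrr.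
  transitivity (\sum_j h (t j) * b j - h c * \sum_j b j).
    by rewrite b0 mulr0 subr0.
  rewrite mulr_sumr -!sumrB; apply: eq_bigr => j _.
  by rewrite /b /e; ring.
rewrite subr_ge0.
pose n i j := normsq ((U *m g' i) j 0).
have n0 i j : 0 <= n i j by exact: normsq_ge0.
have e0 j : 0 <= e j by rewrite subr_ge0 h_le// /t le_max lexx orbT.
have e_mono (i j : 'I_d) : (j <= i)%N -> e i <= e j.
  move=> ji; rewrite lerD2r h_le// /t ge_max !le_max lexx orbT andbT.
  by rewrite a_mono.
apply: (@le_trans _ _ (\sum_(i < d) \sum_(j < d) e j * n (widen_ord hkd i) j)).
  apply: ler_sum => i _.
  have -> : e i * t i = \sum_j e i * n (widen_ord hkd i) j.
    rewrite -mulr_sumr /n -/(vnormsq _) parseval// ga' -/(al i).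
    have [alc|alc] := leP (al i) c.
      by rewrite /e /t (max_idPr _)// subrr !mul0r.
    by rewrite /t (max_idPl _)// ltW.
  apply: ler_sum => j _; have [ji|ij] := leqP j i.
    by rewrite ler_wpM2r// e_mono.
  by rewrite /n schmidt_triangular// normsq0 !mulr0.
rewrite exchange_big; apply: ler_sum => j _ /=.
rewrite -mulr_sumr ler_wpM2l// /mass.
rewrite [leRHS](bigID (fun i : 'I_k => (i < d)%N))/= (big_ord_narrow hkd) lerDl.
by apply: sumr_ge0 => i _; exact: n0.
Qed.

End Spectrum.

(** * The theorem *)

Theorem mainTheorem5 (R : realType) (d k : nat) (hkd : (d <= k)%N)
    (a : 'I_k -> R) (ha_pos : forall i : 'I_k, 0 < a i)
    (ha_mono : forall i j : 'I_k, (i <= j)%N -> a j <= a i)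
    (f : R -> R) (hf_nonneg : forall x : R, 0 <= x -> 0 <= f x)
    (hf_convex : strictly_convex_on `[0, +oo[ f) :
  [set g : {ptws 'I_k -> 'cV[R[i]]_d} |
    is_local_minimizer (prescribed_norms a) (convex_potential f) g] =
  [set g : {ptws 'I_k -> 'cV[R[i]]_d} |
    is_global_minimizer (prescribed_norms a) (convex_potential f) g].
Proof.
rewrite eqEsubset; split => [g gloc|g [ga gmin]]; last first.
  by split => //; rewrite near_withinE; apply: nearW; exact: gmin.
have [ga _] := gloc; split=> // g' g'a.
have normE (h : 'I_k -> 'cV[R[i]]_d) : prescribed_norms a h -> forall i, vnormsq (h i) = a i.
  by move=> ha i; apply: complexI; rewrite -innerE ha.
(* in dimension 0 every potential is an empty sum *)
have [d0|d0] := posnP d.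
  by rewrite /convex_potential !big1// => -[j jd]; exfalso; rewrite d0 in jd.
have [e e0 gmin] := local_minimizer_vnormsq gloc.
have gn0 i : 0 < vnormsq (g i) by rewrite normE.
have {}gmin (h : 'I_k -> 'cV[R[i]]_d) : (forall i, vnormsq (h i) = vnormsq (g i)) ->
    (forall i, vnormsq (h i - g i) < e) ->
  convex_potential f g <= convex_potential f h.
  by move=> hn; apply: gmin => i; rewrite innerE hn normE.
have /choice[lam glam] := local_minimizer_eigenvector hf_convex e0 gn0 gmin.
have gbig i j : frame_eigenvalue g j < lam i -> a i = lam i.
  by rewrite -(normE g)//; exact: (local_minimizer_big hf_convex e0 gn0 gmin glam).
have [c c0 gF] := water_filling_spectrum hkd ha_pos ha_mono d0 (normE _ ga) glam gbig.
exact: (water_filling_optimal ha_mono hf_convex c0 (normE _ ga) (normE _ g'a) gF).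
Qed.
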